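(* Let $m\ge 4$ and $n\ge 2$ be integers and put $a=\lfloor m/2\rfloor$. (1) If $n$ is even, then $M(C_m\square P_n)=an/2$. (2) If $n$ is odd, then $M(C_m\square P_n)=1+a(n-1)/2$ whenever at least one of the following holds: $m$ is even; $m\le 18$; $n\in\{3,5,7,9\}$.
   Context: All graphs are finite and simple. $C_m$ is the cycle on $m$ vertices, $P_n$ is the path on $n$ vertices, and $\square$ denotes the Cartesian product of graphs. For a graph $G$, a vertex $v$ of $G$ and $S\subseteq V(G)$, put $d_S(v)=|N_G(v)\cap S|$, and let $d_G(v)$ be the degree of $v$ in $G$. A nonempty set $S\subseteq V(G)$ is a majority class if $d_S(v)\ge\lceil d_G(v)/2\rceil$ for every $v\in S$. A majority C-colouring of $G$ is a partition of $V(G)$ into majority classes, and $M(G)$ denotes the largest possible number of parts in such a partition. *)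

(* Defs.v *)
From mathcomp Require Import all_boot.

Set Implicit Arguments.
Unset Strict Implicit.
Unset Printing Implicit Defensive.

Record sgraph := SGraph {
  vertex :> finType;
  adj : rel vertex;
  adj_sym : symmetric adj;
  adj_irr : irreflexive adj
}.

Section Majority.
Variable G : sgraph.
Implicit Types (v : G) (S : {set G}) (P : {set {set G}}).

Definition nbhd v : {set G} := [set w | adj v w].

Definition deg v : nat := #|nbhd v|.

Definition deg_in S v : nat := #|nbhd v :&: S|.

(* [uphalf d] is the ceiling of d / 2. *)
Definition majority_class S : bool :=
  (S != set0) && [forall v in S, uphalf (deg v) <= deg_in S v].

Definition majority_Ccolouring P : bool :=
  partition P [set: G] && [forall S in P, majority_class S].

(* The maximum is over a nonempty family: a graph with a vertex has the
   one-part colouring [set setT], and the empty graph has the empty one. *)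
Definition majority_number : nat :=
  \max_(P : {set {set G}} | majority_Ccolouring P) #|P|.

End Majority.

(* [ordS] is the successor modulo m.  The conjunct [i != j] only matters for
   m = 1, where it removes the loop; this is the cycle C_m for m >= 3. *)
Definition cycle_adj m : rel 'I_m :=
  fun i j => (i != j) && ((j == ordS i) || (i == ordS j)).

Lemma cycle_adj_sym m : symmetric (@cycle_adj m).
Proof. by move=> i j; rewrite /cycle_adj eq_sym orbC. Qed.

Lemma cycle_adj_irr m : irreflexive (@cycle_adj m).
Proof. by move=> i; rewrite /cycle_adj eqxx. Qed.

Definition cycle_graph m : sgraph :=
  SGraph (@cycle_adj_sym m) (@cycle_adj_irr m).

Definition path_adj n : rel 'I_n :=
  fun i j => (j == i.+1 :> nat) || (i == j.+1 :> nat).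

Lemma path_adj_sym n : symmetric (@path_adj n).
Proof. by move=> i j; rewrite /path_adj orbC. Qed.

Lemma path_adj_irr n : irreflexive (@path_adj n).
Proof. by move=> i; rewrite /path_adj orbb ltn_eqF. Qed.

Definition path_graph n : sgraph :=
  SGraph (@path_adj_sym n) (@path_adj_irr n).

Definition cart_adj (G H : sgraph) : rel (G * H)%type :=
  fun x y => (x.1 == y.1) && adj x.2 y.2 || adj x.1 y.1 && (x.2 == y.2).

Lemma cart_adj_sym (G H : sgraph) : symmetric (@cart_adj G H).
Proof.
move=> x y; rewrite /cart_adj [adj x.2 _]adj_sym [adj x.1 _]adj_sym.
by rewrite [x.1 == _]eq_sym [x.2 == _]eq_sym.
Qed.

Lemma cart_adj_irr (G H : sgraph) : irreflexive (@cart_adj G H).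
Proof. by move=> x; rewrite /cart_adj !adj_irr andbF. Qed.

Definition cart_prod (G H : sgraph) : sgraph :=
  SGraph (@cart_adj_sym G H) (@cart_adj_irr G H).

(* Main.v *)
(* A class [S] inducing minimum degree at least 2 contains a whole row (a copy
   of C_m), or has at least two vertices in each of two consecutive rows.  The
   sum of |S cap row| / 2 (rounded down) over all classes is at most a in each
   row, and every class contributes at least 2 to the sum over all n rows.
   For n odd, if no class contains a whole row, every class has a pair in one of
   the (n-1)/2 rows of odd index (counting from 0); otherwise some class
   contributes at least a to the sum over all rows. *)
Require Import Defs.
From mathcomp Require Import all_boot zify.

Set Implicit Arguments.
Unset Strict Implicit.
Unset Printing Implicit Defensive.

(** * Neighbourhoods and degrees in the cylinder *)

Lemma nbhd_cart (G H : sgraph) (x : cart_prod G H) :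
  nbhd x = setX (nbhd x.1) [set x.2] :|: setX [set x.1] (nbhd x.2).
Proof.
apply/setP=> -[y1 y2]; rewrite !inE /= /cart_adj /= orbC.
by rewrite ![x.1 == _]eq_sym ![x.2 == _]eq_sym.
Qed.

Lemma deg_cart (G H : sgraph) (x : cart_prod G H) :
  deg x = deg x.1 + deg x.2.
Proof.
rewrite /deg nbhd_cart cardsU !cardsX !cards1 muln1 mul1n.
rewrite (_ : _ :&: _ = set0) ?cards0 ?subn0 //.
apply/setP=> -[y1 y2]; rewrite !inE /=.
by apply/negbTE/negP=> /andP[/andP[a _] /andP[/eqP e _]]; rewrite e adj_irr in a.
Qed.

Lemma val_ordS m (i : 'I_m) : ordS i = (if i.+1 == m then 0 else i.+1) :> nat.
Proof.
have := ltn_ord i; rewrite /=; case: eqP => [->|ne im]; first by rewrite modnn.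
by rewrite modn_small //; lia.
Qed.

Lemma val_ord_pred m (i : 'I_m) :
  ord_pred i = (if i == 0 :> nat then m.-1 else i.-1) :> nat.
Proof.
have := ltn_ord i; rewrite /=; case: posnP => [-> m0|i0 im].
  by rewrite add0n modn_small; lia.
rewrite (_ : (i + m).-1 = i.-1 + m); last by lia.
by rewrite modnDr modn_small; lia.
Qed.

Lemma nbhd_cycle m (i : cycle_graph m) :
  1 < m -> nbhd i = [set ordS i; ord_pred i].
Proof.
move=> m1; apply/setP=> j; rewrite !inE /= /cycle_adj.
have -> : (i == ordS j) = (j == ord_pred i).
  by apply/eqP/eqP=> ->; rewrite ?ordSK ?ord_predK.
apply/andb_idl => /orP[] /eqP->; apply/eqP=> /(congr1 (@nat_of_ord m)).
  by rewrite val_ordS; case: ifP; lia.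
by rewrite val_ord_pred; case: ifP; lia.
Qed.

Lemma deg_cycle m (i : cycle_graph m) : 2 < m -> deg i = 2.
Proof.
move=> m2; rewrite /deg nbhd_cycle ?(ltnW m2) // cards2.
suff -> : ordS i != ord_pred i by [].
apply/eqP=> /(congr1 (@nat_of_ord m)); rewrite val_ordS val_ord_pred.
by have := ltn_ord i; do 2!case: ifP; lia.
Qed.

Lemma deg_path n (j : path_graph n) : 1 < n -> 0 < deg j <= 2.
Proof.
case: n j => // n j n1; apply/andP; split.
  have jn : (j < n.+1)%N := ltn_ord j.
  apply/card_gt0P; exists (inord (if j == 0 :> nat then 1 else j.-1)).
  by rewrite inE /= /path_adj inordK; case: (posnP j) => h; lia.
(* At the ends of the path [j.-1] or the default of [inord] may name a spurious vertex, which is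
   harmless: only an upper bound is sought. *)
apply: leq_trans (_ : #|[set inord j.-1; inord j.+1 : 'I_n.+1]| <= _).
  apply/subset_leq_card/subsetP=> k; rewrite !inE /= /path_adj.
  case/orP=> /eqP h; apply/orP; [right|left]; rewrite -?h ?h.
    by rewrite -h inord_val.
  by rewrite inord_val.
by rewrite cards2; case: eqP.
Qed.

(** Degrees are 3 or 4, and half of either rounds up to 2; so majority classes are the nonempty sets
    inducing minimum degree at least 2. *)
Lemma deg_cylinder m n (x : cart_prod (cycle_graph m) (path_graph n)) :
  2 < m -> 1 < n -> uphalf (deg x) = 2.
Proof.
move=> m2 n1; rewrite deg_cart deg_cycle //.
by have := deg_path x.2 n1; case: (deg _) => [|[|[|]]].
Qed.

(** * Rows met by a majority class *)

(** Iterating [ordS] goes round the whole cycle: [m - i + j] steps lead from [i] to [j]. *)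
Lemma ordS_closed m (A : {set 'I_m}) (i : 'I_m) :
  i \in A -> (forall k, k \in A -> ordS k \in A) -> A = setT.
Proof.
move=> iA clA; apply/setP=> j; rewrite inE.
have it k : exists2 l, l \in A & l = (i + k) %% m :> nat.
  elim: k => [|k [l lA lE]]; first by exists i; rewrite // addn0 modn_small.
  by exists (ordS l); rewrite ?clA //= lE -addn1 modnDml addn1 addnS.
have [l lA lE] := it (m - i + j).
suff <- : l = j by [].
apply: ord_inj; rewrite lE addnA subnKC ?modnDl ?modn_small //.
exact/ltnW/ltn_ord.
Qed.

(** The complement of [A] is closed under [ordS], so it would be everything if it were nonempty. *)
Lemma ord_pred_closed m (A : {set 'I_m}) (i : 'I_m) :
  i \in A -> (forall k, k \in A -> ord_pred k \in A) -> A = setT.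
Proof.
move=> iA clA; apply/setP=> j; rewrite inE; apply/negPn/negP=> jA.
have /setP/(_ i) : ~: A = setT.
  apply: (@ordS_closed _ _ j) => [|k]; rewrite !inE // => kA.
  by apply: contra kA => /clA; rewrite ordSK.
by rewrite !inE iA.
Qed.

Definition row m n (S : {set 'I_m * 'I_n}) (t : 'I_n) : {set 'I_m} :=
  [set i | (i, t) \in S].

(* In the topmost row met by [S], unless that row is full, the two ends of a
   maximal run are distinct and each needs a neighbour in the next row. *)
Lemma majority_class_rows m n
    (S : {set cart_prod (cycle_graph m) (path_graph n)}) :
  2 < m -> 1 < n -> majority_class S ->
  (exists t, row S t = setT) \/
  (exists t u : 'I_n, [/\ u = t.+1 :> nat, 1 < #|row S t| & 1 < #|row S u|]).
Proof.
move=> m2 n1 /andP[/set0Pn[[i0 t0] S0] /forall_inP majS].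
have [t [i it] tmin] : exists2 t : 'I_n, (exists i, (i, t) \in S) &
    forall i s, (i, s) \in S -> t <= s.
  have P0 : row S t0 != set0 by apply/set0Pn; exists i0; rewrite inE.
  case: (@arg_minnP _ t0 (fun t => row S t != set0) val P0) => t Pt tmin.
  exists t; first by case/set0Pn: Pt => i; rewrite inE; exists i.
  by move=> i s iS; apply: tmin; apply/set0Pn; exists i; rewrite inE.
case: (eqVneq (row S t) setT) => [|nfull]; [by left; exists t | right].
(* By minimality of [t] no neighbour in [S] lies in the previous row, so each of the two is beside
   [l] or in row [t.+1]. *)
have nb l : (l, t) \in S -> exists x y, [/\ x \in S, y \in S, x != y &
    forall z, z \in [:: x; y] ->
    [\/ z = (ordS l, t), z = (ord_pred l, t) | z.1 = l /\ z.2 = t.+1 :> nat]].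
  move=> /[dup] lS /majS; rewrite deg_cylinder // => /card_gt1P[x [y [xN yN xy]]].
  move: xN yN; rewrite !inE => /andP[xN xS] /andP[yN yS].
  exists x, y; split=> // z zxy.
  have [zN zS] : z \in nbhd ((l, t) : cart_prod (cycle_graph m) (path_graph n)) /\ z \in S.
    by move: zxy; rewrite !inE => /orP[] /eqP->.
  move: zN; rewrite nbhd_cart nbhd_cycle ?(ltnW m2) //.
  case: z zS {zxy} => z1 z2 zS; rewrite !inE /= /path_adj.
  case/orP=> /andP[].
    by case/orP=> /eqP-> /eqP->; [constructor 1 | constructor 2].
  move=> /eqP z1l /orP[/eqP e | /eqP e]; first by constructor 3.
  by have := tmin _ _ zS; rewrite e ltnn.
(* A row that is not full is not closed under [ordS], so some run ends at [r]; likewise some run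
   begins at [l]. *)
have [r rS rN] : exists2 r, (r, t) \in S & (ordS r, t) \notin S.
  apply/exists_inP; apply: contraR nfull; rewrite negb_exists_in => /forall_inP h.
  apply/eqP/(@ordS_closed _ _ i); rewrite ?inE // => k; rewrite !inE => /h.
  by rewrite negbK.
have [l lS lN] : exists2 l, (l, t) \in S & (ord_pred l, t) \notin S.
  apply/exists_inP; apply: contraR nfull; rewrite negb_exists_in => /forall_inP h.
  apply/eqP/(@ord_pred_closed _ _ i); rewrite ?inE // => k; rewrite !inE => /h.
  by rewrite negbK.
(* A run of a single vertex has no horizontal neighbour in [S], and only one neighbour in the next
   row, which is one too few. *)
have rl : r != l.
  apply: contraNneq lN => rl; rewrite -rl in lS *.
  have [x [y [xS yS xy h]]] := nb _ rS.
  have := h x; have := h y; rewrite !inE !eqxx orbT => /(_ isT) hy /(_ isT) hx.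
  case: hx => [hx|hx|[hx1 hx2]]; rewrite ?hx in xS xy; rewrite ?xS // in rN *.
  case: hy => [hy|hy|[hy1 hy2]]; rewrite ?hy in yS xy; rewrite ?yS // in rN *.
  case/negP: xy; apply/eqP; case: x y hx1 hx2 hy1 hy2 {xS yS h} => [? ?] [? ?] /=.
  by move=> -> e -> e'; congr (_, _); apply: ord_inj; rewrite e e'.
(* With one horizontal neighbour missing, two distinct neighbours in [S] force one of them to be in
   the next row. *)
have below k : (k, t) \in S -> (ordS k, t) \notin S \/ (ord_pred k, t) \notin S ->
    exists2 u : 'I_n, u = t.+1 :> nat & (k, u) \in S.
  move=> kS kN; have [[x1 x2] [[y1 y2] [xS yS xy h]]] := nb _ kS.
  have := h (x1, x2); have := h (y1, y2).
  rewrite !inE !eqxx orbT => /(_ isT) hy /(_ isT) hx.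
  case: hx => [hx|hx|[hx1 hx2]]; last by exists x2 => //; rewrite -[k]hx1.
    case: hy => [hy|hy|[hy1 hy2]]; last by exists y2 => //; rewrite -[k]hy1.
      by rewrite hx hy eqxx in xy.
    by case: kN; rewrite -?hx -?hy ?xS ?yS.
  case: hy => [hy|hy|[hy1 hy2]]; last by exists y2 => //; rewrite -[k]hy1.
    by case: kN; rewrite -?hx -?hy ?xS ?yS.
  by rewrite hx hy eqxx in xy.
have [u ut uS] := below r rS (or_introl rN).
have [u' ut' uS'] := below l lS (or_intror lN).
have uu' : u' = u by apply: ord_inj; rewrite ut ut'.
exists t, u; split=> //; apply/card_gt1P; exists r, l; split; rewrite // inE //.
by rewrite -uu'.
Qed.

(** * Upper bounds by counting pairs in rows *)

(** The classes cut row [t] into disjoint subsets of the [m] columns, and rounding each half down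
    only decreases the sum. *)
Lemma sum_row_half m n (P : {set {set 'I_m * 'I_n}}) (t : 'I_n) :
  trivIset P -> \sum_(S in P) #|row S t|./2 <= m./2.
Proof.
move=> tP; rewrite geq_half_double -mul2n big_distrr /=.
apply: (@leq_trans (\sum_(S in P) #|row S t|)).
  by apply: leq_sum => S _; rewrite mul2n -geq_half_double.
under eq_bigr => S _ do rewrite -sum1_card big_mkcond /=.
rewrite exchange_big /= -[leqRHS]card_ord -sum1_card; apply: leq_sum => i _.
rewrite -big_mkcondr /= (eq_bigl [pred S in P | (i, t) \in S]) => [|S];
  last by rewrite !inE.
rewrite sum1_card; apply/card_le1_eqP => S U.
move=> /andP[SP iS] /andP[UP iU].
by rewrite -(def_pblock tP SP iS) (def_pblock tP UP iU).
Qed.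

Lemma sum_rows_half m n (P : {set {set 'I_m * 'I_n}}) :
  trivIset P -> \sum_(S in P) \sum_t #|row S t|./2 <= m./2 * n.
Proof.
move=> tP; rewrite exchange_big /=.
rewrite mulnC -[n in leqRHS]card_ord -sum_nat_const.
by apply: leq_sum => t _; apply: sum_row_half.
Qed.

Lemma sum_odd n c : \sum_(t < n | odd t) c = n./2 * c.
Proof.
rewrite big_mkcond /=; elim: n => [|n IHn]; first by rewrite big_ord0.
by rewrite big_ord_recr /= IHn uphalf_half; case: (odd n); rewrite ?addn0 // mulSn addnC.
Qed.

Section Upper.
Variables (m n : nat) (m4 : 3 < m) (n2 : 1 < n).
Let G := cart_prod (cycle_graph m) (path_graph n).
Variables (P : {set {set G}}) (cP : majority_Ccolouring P).

Let tP : trivIset P.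
Proof. by case/andP: cP => /and3P[]. Qed.

Let rowsP S : S \in P ->
  (exists t, row S t = setT) \/
  (exists t u : 'I_n, [/\ u = t.+1 :> nat, 1 < #|row S t| & 1 < #|row S u|]).
Proof.
move=> SP; apply: majority_class_rows; rewrite ?(ltnW m4) //.
by case/andP: cP => _ /forall_inP; apply.
Qed.

Let rows_ge2 S : S \in P -> 1 < \sum_t #|row S t|./2.
Proof.
move=> /rowsP[[t tS] | [t [u [tu ht hu]]]].
  (* A full row alone gives [m./2], which is at least 2 because [m] is at least 4. *)
  by rewrite (bigD1 t) //= tS cardsT card_ord; apply: leq_trans (leq_addr _ _); lia.
rewrite (bigD1 t) //= (bigD1 u) /=.
  rewrite addnA; apply: leq_trans (leq_addr _ _).
  by rewrite -[2]/(1 + 1) leq_add // half_gt0.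
by apply/eqP=> e; move: tu; rewrite e; lia.
Qed.

Lemma colouring_le_half : #|P|.*2 <= m./2 * n.
Proof.
apply: leq_trans (sum_rows_half tP); rewrite -muln2 -sum_nat_const.
by apply: leq_sum => S; apply: rows_ge2.
Qed.

Lemma colouring_le_odd : odd n -> #|P| <= 1 + m./2 * n./2.
Proof.
move=> on; case: (boolP [exists (S | S \in P), exists t, row S t == setT]).
  case/exists_inP=> T TP /existsP[t /eqP tT].
  have := sum_rows_half tP; rewrite (bigD1 T) //=.
  have : m./2 <= \sum_t #|row T t|./2.
    by rewrite (bigD1 t) //= tT cardsT card_ord leq_addr.
  have : (#|P|.-1).*2 <= \sum_(S in P | S != T) \sum_t #|row S t|./2.
    rewrite (cardsD1 T) TP /= -muln2 -sum_nat_const.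
    rewrite (eq_bigl (fun S => (S \in P) && (S != T))) => [|S]; last first.
      by rewrite !inE andbC.
    by apply: leq_sum => S /andP[SP _]; apply: rows_ge2.
  (* With [a = m./2] and [n = 2 * b + 1], the bounds combine to
     [a + 2 * (#|P| - 1) <= a * (2 * b + 1)]. *)
  have : n = n./2.*2.+1 by lia.
  move: (\sum_(_ in _ | _) _) (\sum_t _) #|_| => x y k; move: (m./2) (n./2) => a b ->.
  by rewrite mulnS -doubleMr; lia.
(* Without full rows the stronger bound [m./2 * n./2] holds, since one of any two consecutive rows
   has odd index. *)
rewrite negb_exists_in => /forall_inP nfull; rewrite add1n; apply: leqW.
apply: (@leq_trans (\sum_(S in P) \sum_(t < n | odd t) #|row S t|./2)).
  rewrite -sum1_card; apply: leq_sum => S SP; case: (rowsP SP) => [[t tS]|].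
    by case/existsP: (nfull _ SP); exists t; apply/eqP.
  case=> t [u [tu ht hu]]; have [ot|et] := boolP (odd t).
    by rewrite (bigD1 t) //=; apply: leq_trans (leq_addr _ _); rewrite half_gt0.
  by rewrite (bigD1 u) /= ?tu //; apply: leq_trans (leq_addr _ _); rewrite half_gt0.
rewrite exchange_big /= mulnC -sum_odd.
by apply: leq_sum => t _; apply: sum_row_half.
Qed.

End Upper.

(** * Lower bound by an explicit colouring *)

(** The nonempty fibres of [f] are the parts; distinct values below [k] give distinct fibres, so
    there are at least [k] of them. *)
Lemma majority_number_ge (G : sgraph) (f : G -> nat) k :
  (forall v, uphalf (deg v) <= #|[set w in nbhd v | f w == f v]|) ->
  (forall c, c < k -> exists v, f v = c) -> k <= majority_number G.
Proof.
move=> fmaj fsurj; pose P := preim_partition f [set: G].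
have PP : partition P [set: G] by apply: preim_partitionP.
have fibre v : [set w | f w == f v] \in P.
  by apply/imsetP; exists v => //; apply/setP=> w; rewrite !inE /= eq_sym.
apply: (@leq_trans #|P|).
  pose F (c : 'I_k) := [set v | f v == c].
  have Finj : injective F.
    move=> c d /setP; have [v vc] := fsurj c (ltn_ord c).
    by move=> /(_ v); rewrite !inE vc eqxx => /esym/eqP/val_inj.
  rewrite -[k]card_ord -(card_imset _ Finj); apply/subset_leq_card/subsetP.
  by move=> _ /imsetP[c _ ->]; have [v vc] := fsurj c (ltn_ord c); rewrite /F -vc.
apply: (@leq_bigmax_cond _ _ (fun P : {set {set G}} => #|P|)).
rewrite /majority_Ccolouring PP; apply/forall_inP=> S /imsetP[v _ ->].
apply/andP; split; first by apply/set0Pn; exists v; rewrite !inE /=.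
apply/forall_inP=> w; rewrite !inE /= => /eqP vw.
apply: leq_trans (fmaj w) _; apply/subset_leq_card/subsetP=> u.
by rewrite !inE /= -vw [f v == _]eq_sym.
Qed.

(* Blocks two rows high and two columns wide (three for the last block of
   columns when [m] is odd); when [n] is odd the last row is one class. *)
Definition block_colour m n (x : 'I_m * 'I_n) : nat :=
  if x.2./2 < n./2 then x.2./2 * m./2 + minn x.1./2 (m./2).-1 else n./2 * m./2.

Lemma block_colour_majority m n (v : cart_prod (cycle_graph m) (path_graph n)) :
  2 < m -> 1 < n ->
  uphalf (deg v) <= #|[set w in nbhd v | block_colour w == block_colour v]|.
Proof.
move=> m2 n1; rewrite deg_cylinder //; case: v => i j; apply/card_gt1P.
have im := ltn_ord i; have jn := ltn_ord j.
(* Outside the two-row blocks [j] is the last row for odd [n], where both neighbours along the cycle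
   share the colour. *)
have [jlt|jge] := ltnP j./2 n./2; last first.
  have : 1 < #|nbhd i| by rewrite -/(deg i) deg_cycle.
  case/card_gt1P=> x [y [xi yi xy]]; exists (x, j), (y, j).
  rewrite !inE /= in xi yi; rewrite xpair_eqE negb_and xy.
  by split; rewrite ?inE /= /cart_adj /= ?xi ?yi ?eqxx ?orbT
                    /block_colour /= ?ltnNge ?jge ?eqxx.
(* Inside a block, one neighbour is horizontal: even columns pair with the next one, odd columns
   with the previous one. For odd [m] the last column goes back to [m - 2], and [minn] equates their
   block indices. *)
have [k kE] : exists k : 'I_m, cycle_adj i k /\ minn k./2 (m./2).-1 = minn i./2 (m./2).-1.
  have adjS (p q : 'I_m) : q = p.+1 :> nat -> cycle_adj p q.
    move=> e; rewrite /cycle_adj -!val_eqE /= e modn_small -?e ?ltn_ord // eqxx andbT.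
    by rewrite e; lia.
  have [h|h] := boolP (~~ odd i && (i.+1 < m)).
    by exists (Ordinal (proj2 (andP h))); split; [exact: adjS | move=> /=; lia].
  have im' : i.-1 < m by lia.
  exists (Ordinal im'); split; last by move=> /=; lia.
  by rewrite cycle_adj_sym; apply: adjS => /=; lia.
(* The other neighbour is vertical, in the second row of the block. *)
have ln : (if odd j then j.-1 else j.+1) < n by case: ifP; lia.
have [l lE] : exists l : 'I_n, l = (if odd j then j.-1 else j.+1) :> nat.
  by exists (Ordinal ln).
exists (k, j), (i, l); case: kE => ik ke.
split; rewrite ?inE /= /cart_adj /=.
- by rewrite ik eqxx orbT /block_colour /= ke eqxx.
- rewrite eqxx /path_adj /= /block_colour /= lE.
  by case: ifP => oj; rewrite (_ : _./2 = j./2) ?eqxx ?andbT; lia.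
- rewrite xpair_eqE -[j == _]val_eqE /= lE negb_and; apply/orP; right.
  by apply/eqP; case: ifP; lia.
Qed.

(** Division of [c] by [m./2] gives the block row as quotient and the block column as remainder; the
    top value, present for odd [n], is taken on the last row. *)
Lemma block_colour_surj m n c : 1 < m -> 1 < n ->
  c < n./2 * m./2 + odd n ->
  exists v : 'I_m * 'I_n, block_colour v = c.
Proof.
move=> m1 n1 hc; have [clt|cge] := ltnP c (n./2 * m./2); last first.
  have hi : 0 < m by lia.
  have hj : n.-1 < n by lia.
  exists (Ordinal hi, Ordinal hj); rewrite /block_colour /=.
  by case: ifP; lia.
have a0 : 0 < m./2 by lia.
have hq : c %/ m./2 < n./2 by rewrite ltn_divLR.
have hr : c %% m./2 < m./2 by rewrite ltn_mod.
have hi : (c %% m./2).*2 < m by lia.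
have hj : (c %/ m./2).*2 < n by lia.
exists (Ordinal hi, Ordinal hj); rewrite /block_colour /= !doubleK hq.
by rewrite (minn_idPl _) -?divn_eq //; lia.
Qed.

Theorem theorem2 (m n : nat) (hm : 4 <= m) (hn : 2 <= n) :
  let a := m %/ 2 in
  let M := majority_number (cart_prod (cycle_graph m) (path_graph n)) in
  (~~ odd n -> M = (a * n) %/ 2) /\
  (odd n -> ~~ odd m \/ m <= 18 \/ n \in [:: 3; 5; 7; 9] ->
     M = 1 + (a * (n - 1)) %/ 2).
Proof.
move=> a M.
have lower : n./2 * m./2 + odd n <= M.
  apply: (@majority_number_ge (cart_prod (cycle_graph m) (path_graph n))
                                    (@block_colour m n)) => [v|c].
    by apply: block_colour_majority => //; apply: ltnW.
  by apply: block_colour_surj => //; lia.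
have aE : a = m./2 by rewrite /a divn2.
split=> [en | on _]; apply/eqP; rewrite eqn_leq; apply/andP; split.
- apply/bigmax_leqP => P cP; have := colouring_le_half hm hn cP.
  by rewrite aE; lia.
- apply: leq_trans lower; rewrite aE.
  have -> : m./2 * n = (n./2 * m./2) * 2 by nia.
  by rewrite mulnK // leq_addr.
- apply/bigmax_leqP => P cP; have := colouring_le_odd hm hn cP on.
  rewrite aE; have -> : m./2 * (n - 1) = m./2 * n./2 * 2 by nia.
  by rewrite mulnK.
- apply: leq_trans lower; rewrite aE on.
  have -> : m./2 * (n - 1) = (n./2 * m./2) * 2 by nia.
  by rewrite mulnK // addnC.
Qed.
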